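(* Let $\mathrm{Ax}$ be a subset of $\{\mathsf{refl},\mathsf{cond},\mathsf{veq},\mathsf{cs}\}$, where $\mathsf{refl}$ is $\top\trianglelefteq p\Rightarrow p$, $\mathsf{cond}$ is $p\trianglelefteq\top\Rightarrow p$, $\mathsf{veq}$ is $p\trianglelefteq q\Rightarrow p$ and $\mathsf{cs}$ is $p\wedge q\trianglelefteq p\Rightarrow q$. Then $\mathbf{CL}(\mathrm{Ax})$ is sound and complete with respect to the class of selection L-frames $(X,1,\curlywedge,s)$ satisfying, for each axiom in $\mathrm{Ax}$, its corresponding condition (all $x\in X$ and filters $a,b$): for $\mathsf{refl}$: $s(x,a)\subseteq a$; for $\mathsf{cond}$: $x\in a$ implies $s(x,X)\subseteq a$; for $\mathsf{veq}$: $x\in a$ implies $s(x,b)\subseteq a$; for $\mathsf{cs}$: $x\in a\cap b$ implies $s(x,a)\subseteq b$. That is, a consequence pair belongs to $\mathbf{CL}(\mathrm{Ax})$ iff it is validated by every selection L-frame in this class.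
   Context: Formulas: $\phi::=p\mid\top\mid\bot\mid\phi\wedge\phi\mid\phi\vee\phi\mid\phi\Rightarrow\phi$. $\mathbf{CL}(\Gamma)$ is the smallest set of consequence pairs $\phi\trianglelefteq\psi$ containing $\Gamma$, closed under uniform substitution, containing $p\trianglelefteq\top$, $\bot\trianglelefteq p$, $p\trianglelefteq p$, $p\wedge q\trianglelefteq p$, $p\wedge q\trianglelefteq q$, $p\trianglelefteq p\vee q$, $q\trianglelefteq p\vee q$, $\top\trianglelefteq p\Rightarrow\top$, $p\Rightarrow(q\wedge r)\trianglelefteq(p\Rightarrow q)\wedge(p\Rightarrow r)$, $(p\Rightarrow q)\wedge(p\Rightarrow r)\trianglelefteq p\Rightarrow(q\wedge r)$, closed under transitivity, $\wedge$-introduction (from $r\trianglelefteq p,r\trianglelefteq q$ infer $r\trianglelefteq p\wedge q$), $\vee$-elimination (from $p\trianglelefteq r,q\trianglelefteq r$ infer $p\vee q\trianglelefteq r$), and congruence for $\Rightarrow$ in each argument. A selection L-frame is a meet-semilattice $(X,1,\curlywedge)$ ($x\preccurlyeq y$ iff $x\curlywedge y=x$) with $s:X\times\mathcal F(X)\to\mathcal F(X)$ ($\mathcal F(X)$ the filters: upward closed, closed under finite meets) such that $s(1,a)=\{1\}$; $x\preccurlyeq y$ implies $s(y,a)\subseteq s(x,a)$; if $z\in s(x\curlywedge y,a)$ there are $u\in s(x,a)$, $v\in s(y,a)$ with $u\curlywedge v\preccurlyeq z$. Under a valuation $V$ (letters to filters): $x\Vdash p$ iff $x\in V(p)$; $\top$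 always; $x\Vdash\bot$ iff $x=1$; $\wedge$ pointwise; $x\Vdash\phi\vee\psi$ iff some $y\Vdash\phi$, $z\Vdash\psi$ have $y\curlywedge z\preccurlyeq x$; $x\Vdash\phi\Rightarrow\psi$ iff $s(x,[\![\phi]\!])\subseteq[\![\psi]\!]$. A frame validates $\phi\trianglelefteq\psi$ if $[\![\phi]\!]\subseteq[\![\psi]\!]$ for all valuations. *)

(* Defs.v *)
From HB Require Import structures.
From mathcomp Require Import all_boot all_order.
From mathcomp Require Import boolp classical_sets.

Set Implicit Arguments.
Unset Strict Implicit.
Unset Printing Implicit Defensive.

Import Order.TTheory.

Local Open Scope classical_set_scope.
Local Open Scope order_scope.

Inductive formula : Type :=
| Var of nat
| Top
| Bot
| And of formula & formula
| Or of formula & formula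
| Imp of formula & formula.

Fixpoint subst (sigma : nat -> formula) (phi : formula) : formula :=
  match phi with
  | Var n => sigma n
  | Top => Top
  | Bot => Bot
  | And phi1 phi2 => And (subst sigma phi1) (subst sigma phi2)
  | Or phi1 phi2 => Or (subst sigma phi1) (subst sigma phi2)
  | Imp phi1 phi2 => Imp (subst sigma phi1) (subst sigma phi2)
  end.

Local Notation p := (Var 0) (only parsing).
Local Notation q := (Var 1) (only parsing).
Local Notation r := (Var 2) (only parsing).

(* [CL G phi psi] says that the consequence pair (phi, psi) is in CL(G).      *)
(* The axioms are single pairs in the letters p, q, r, whose instances come   *)
(* from [CL_subst]; the rules apply to arbitrary formulas.                    *)
Inductive CL (G : set (formula * formula)) : formula -> formula -> Prop :=
| CL_ax phi psi : G (phi, psi) -> CL G phi psi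
| CL_subst sigma phi psi :
    CL G phi psi -> CL G (subst sigma phi) (subst sigma psi)
| CL_top : CL G p Top
| CL_bot : CL G Bot p
| CL_id : CL G p p
| CL_andl : CL G (And p q) p
| CL_andr : CL G (And p q) q
| CL_orl : CL G p (Or p q)
| CL_orr : CL G q (Or p q)
| CL_imp_top : CL G Top (Imp p Top)
| CL_imp_and1 : CL G (Imp p (And q r)) (And (Imp p q) (Imp p r))
| CL_imp_and2 : CL G (And (Imp p q) (Imp p r)) (Imp p (And q r))
| CL_trans phi psi chi : CL G phi psi -> CL G psi chi -> CL G phi chi
| CL_andI phi psi chi :
    CL G chi phi -> CL G chi psi -> CL G chi (And phi psi)
| CL_orE phi psi chi :
    CL G phi chi -> CL G psi chi -> CL G (Or phi psi) chi
| CL_congl phi psi chi :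
    CL G phi psi -> CL G psi phi -> CL G (Imp phi chi) (Imp psi chi)
| CL_congr phi psi chi :
    CL G phi psi -> CL G psi phi -> CL G (Imp chi phi) (Imp chi psi).

Inductive axiom_name : Type := Ax_refl | Ax_cond | Ax_veq | Ax_cs.

Definition axiom_pair (ax : axiom_name) : formula * formula :=
  match ax with
  | Ax_refl => (Top, Imp p p)
  | Ax_cond => (p, Imp Top p)
  | Ax_veq => (p, Imp q p)
  | Ax_cs => (And p q, Imp p q)
  end.

Identity Coercion set_to_fun : set >-> Funclass.

(* The empty meet is a finite meet, so filters contain the top element.       *)
Record sfilter d (X : tMeetSemilatticeType d) := SFilter {
  sfilter_set :> set X;
  sfilter_top : sfilter_set \top;
  sfilter_meet : forall x y,
    sfilter_set x -> sfilter_set y -> sfilter_set (x `&` y);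
  sfilter_up : forall x y, x <= y -> sfilter_set x -> sfilter_set y }.

(* The order of a [tMeetSemilatticeType] is the meet order ([leEmeet]). Its   *)
(* carrier is a [choiceType]; under the axioms of [boolp] every type is one   *)
(* ([gen_eqMixin], [gen_choiceMixin]), so this does not restrict the frames.  *)
Record selection_Lframe := SelectionLFrame {
  frame_disp : Order.disp_t;
  frame_sort :> tMeetSemilatticeType frame_disp;
  sel : frame_sort -> sfilter frame_sort -> sfilter frame_sort;
  sel_top : forall a, sel \top a = [set \top] :> set frame_sort;
  sel_le : forall x y a, x <= y -> sel y a `<=` sel x a;
  sel_meet : forall x y z a, sel (x `&` y) a z ->
    exists u v, [/\ sel x a u, sel y a v & u `&` v <= z] }.

Local Obligation Tactic := idtac.

Section Filters.
Context d (X : tMeetSemilatticeType d).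
Implicit Types a b : sfilter X.

Program Definition sfilterT : sfilter X := @SFilter d X setT _ _ _.
Solve Obligations with by [].

Program Definition sfilter1 : sfilter X := @SFilter d X [set \top] _ _ _.
Next Obligation. by []. Qed.
Next Obligation. by move=> x y /= -> ->; rewrite meetxx. Qed.
Next Obligation. by move=> x y /= + xE; rewrite xE le1x => /eqP. Qed.

Program Definition sfilterI a b : sfilter X :=
  @SFilter d X (a `&` b)%classic _ _ _.
Next Obligation. by move=> a b; split; apply: sfilter_top. Qed.
Next Obligation.
by move=> a b x y [ax bx] [ay b_y]; split; apply: sfilter_meet.
Qed.
Next Obligation.
by move=> a b x y xy [ax bx]; split; apply: sfilter_up xy _.
Qed.

Program Definition sfilter_join a b : sfilter X :=
  @SFilter d X [set x | exists y z, [/\ a y, b z & y `&` z <= x]] _ _ _.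
Next Obligation.
by move=> a b; exists \top, \top; split; [exact: sfilter_top..|exact: lex1].
Qed.
Next Obligation.
move=> a b x x' [y [z [ay bz yzx]]] [y' [z' [ay' bz' yzx']]].
exists (y `&` y'), (z `&` z'); split; [exact: sfilter_meet..|].
by rewrite meetACA leI2.
Qed.
Next Obligation.
move=> a b x x' xx' [y [z [ay bz yzx]]].
by exists y, z; split=> //; apply: le_trans xx'.
Qed.

End Filters.

Section Semantics.
Variable F : selection_Lframe.

Program Definition sfilter_imp (a b : sfilter F) : sfilter F :=
  @SFilter _ F [set x | sel x a `<=` b] _ _ _.
Next Obligation.
by move=> a b /=; rewrite sel_top => _ ->; apply: sfilter_top.
Qed.
Next Obligation.
move=> a b x y /= xab yab z /sel_meet[u [v [xu yv]]] /sfilter_up; apply.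
by apply: sfilter_meet; [exact: xab|exact: yab].
Qed.
Next Obligation.
by move=> a b x y xy /= xab z yz; apply: xab; apply: sel_le yz.
Qed.

(* The truth set of [phi]; that it is a filter is what makes [sel x] apply to *)
(* it in the clause for [Imp].                                                *)
Fixpoint truth_set (V : nat -> sfilter F) (phi : formula) : sfilter F :=
  match phi with
  | Var n => V n
  | Top => sfilterT F
  | Bot => sfilter1 F
  | And phi1 phi2 => sfilterI (truth_set V phi1) (truth_set V phi2)
  | Or phi1 phi2 => sfilter_join (truth_set V phi1) (truth_set V phi2)
  | Imp phi1 phi2 => sfilter_imp (truth_set V phi1) (truth_set V phi2)
  end.

Definition validates (phi psi : formula) : Prop :=
  forall V : nat -> sfilter F, truth_set V phi `<=` truth_set V psi.

Definition axiom_condition (ax : axiom_name) : Prop :=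
  match ax with
  | Ax_refl => forall (x : F) (a : sfilter F), sel x a `<=` a
  | Ax_cond => forall (x : F) (a : sfilter F), a x -> sel x (sfilterT F) `<=` a
  | Ax_veq => forall (x : F) (a b : sfilter F), a x -> sel x b `<=` a
  | Ax_cs => forall (x : F) (a b : sfilter F),
                (a `&` b)%classic x -> sel x a `<=` b
  end.

End Semantics.

(* Main.v *)
(* Completeness uses the filters of the Lindenbaum preorder ("theories"),
   ordered by inclusion, as worlds. For a filter [a] of theories, put
   x_a = {psi | phi => psi \in x for every phi defining a}, where [phi] defines
   [a] if [a] is the set of theories containing [phi], and let [s(x, a)] be the
   principal filter above [x_a]. If [a] is not definable then [x_a] is the
   improper theory, so that s(x, a) = {1}; hence each frame condition has to be
   checked at definable filters only, where it is the axiom itself. *)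
Require Import Defs.
From HB Require Import structures.
From mathcomp Require Import all_boot all_order.
From mathcomp Require Import boolp classical_sets.

Local Open Scope classical_set_scope.

Set Implicit Arguments.
Unset Strict Implicit.
Unset Printing Implicit Defensive.

Import Order.TTheory.

(** [sel] takes a filter as a record, so exchanging two truth sets under it needs equality of
    records; proof irrelevance supplies this. *)
Lemma sfilter_eq d (X : tMeetSemilatticeType d) (a b : sfilter X) :
  a = b :> set X -> a = b.
Proof.
case: a b => [A At Am Au] [B Bt Bm Bu] /= AB; case: B / AB Bt Bm Bu => Bt Bm Bu.
by rewrite (Prop_irrelevance At Bt) (Prop_irrelevance Am Bm)
  (Prop_irrelevance Au Bu).
Qed.

(** * Soundness *)

Section Soundness.
Variable F : selection_Lframe.
Implicit Type V : nat -> sfilter F.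

Lemma truth_set_subst V sigma phi :
  truth_set V (subst sigma phi) = truth_set (fun n => truth_set V (sigma n)) phi.
Proof. by elim: phi => //= phi1 -> phi2 ->. Qed.

Lemma validates_subst sigma phi psi :
  validates F phi psi -> validates F (subst sigma phi) (subst sigma psi).
Proof. by move=> phi_psi V; rewrite !truth_set_subst; apply: phi_psi. Qed.

(** This validates the congruence rules: interderivable formulas give [sel] the very same
    argument. *)
Lemma truth_set_eq V phi psi :
  validates F phi psi -> validates F psi phi -> truth_set V phi = truth_set V psi.
Proof. by move=> pq qp; apply: sfilter_eq; apply/seteqP; split. Qed.

Lemma axiom_valid ax :
  axiom_condition F ax -> validates F (axiom_pair ax).1 (axiom_pair ax).2.
Proof.
by case: ax => /= cond V x /=; [move=> _; apply: cond|apply: cond..].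
Qed.

Lemma CL_sound (G : set (formula * formula)) phi psi :
    (forall c, G c -> validates F c.1 c.2) ->
  CL G phi psi -> validates F phi psi.
Proof.
move=> G_valid; elim=> {phi psi}.
- by move=> phi psi /G_valid.
- by move=> sigma phi psi _; apply: validates_subst.
- by move=> V x.
- by move=> V x /= ->; apply: sfilter_top.
- by move=> V x.
- by move=> V x [].
- by move=> V x [].
- move=> V x /= Vx; exists x, \top%O.
  by split; [|exact: sfilter_top|rewrite meetx1].
- move=> V x /= Vx; exists \top%O, x.
  by split; [exact: sfilter_top| |rewrite meet1x].
- by move=> V x _ y.
- by move=> V x /= xqr; split=> y /xqr[].
- by move=> V x /= [xq xr] y sy; split; [apply: xq|apply: xr].
- by move=> phi psi chi _ phi_psi _ psi_chi V x /phi_psi/psi_chi.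
- move=> phi psi chi _ chi_phi _ chi_psi V x.
  by split; [apply: chi_phi|apply: chi_psi].
- move=> phi psi chi _ phi_chi _ psi_chi V x [y [z [/phi_chi cy /psi_chi cz]]].
  by move/sfilter_up; apply; apply: sfilter_meet.
- by move=> phi psi chi _ pq _ qp V /=; rewrite (truth_set_eq V pq qp).
- by move=> phi psi chi _ pq _ qp V /=; rewrite (truth_set_eq V pq qp).
Qed.

End Soundness.

(** * Instances of the axioms, and monotonicity of the conditional *)

Section Derivations.
Variable G : set (formula * formula).
Implicit Types phi psi chi : formula.

(** Instantiates the letters p, q, r; the default [Top] goes to letters that no axiom contains. *)
Definition subst3 phi psi chi : nat -> formula := nth Top [:: phi; psi; chi].

Lemma CL_refl phi : CL G phi phi.
Proof. exact: (CL_subst (subst3 phi phi phi) (CL_id G)). Qed.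

Lemma CL_le_top phi : CL G phi Top.
Proof. exact: (CL_subst (subst3 phi phi phi) (CL_top G)). Qed.

Lemma CL_bot_le phi : CL G Bot phi.
Proof. exact: (CL_subst (subst3 phi phi phi) (CL_bot G)). Qed.

Lemma CL_and_le1 phi psi : CL G (And phi psi) phi.
Proof. exact: (CL_subst (subst3 phi psi psi) (CL_andl G)). Qed.

Lemma CL_and_le2 phi psi : CL G (And phi psi) psi.
Proof. exact: (CL_subst (subst3 phi psi psi) (CL_andr G)). Qed.

Lemma CL_or_ge1 phi psi : CL G phi (Or phi psi).
Proof. exact: (CL_subst (subst3 phi psi psi) (CL_orl G)). Qed.

Lemma CL_or_ge2 phi psi : CL G psi (Or phi psi).
Proof. exact: (CL_subst (subst3 phi psi psi) (CL_orr G)). Qed.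

Lemma CL_top_imp phi : CL G Top (Imp phi Top).
Proof. exact: (CL_subst (subst3 phi phi phi) (CL_imp_top G)). Qed.

Lemma CL_imp_andE phi psi chi :
  CL G (Imp phi (And psi chi)) (And (Imp phi psi) (Imp phi chi)).
Proof. exact: (CL_subst (subst3 phi psi chi) (CL_imp_and1 G)). Qed.

Lemma CL_imp_andI phi psi chi :
  CL G (And (Imp phi psi) (Imp phi chi)) (Imp phi (And psi chi)).
Proof. exact: (CL_subst (subst3 phi psi chi) (CL_imp_and2 G)). Qed.

(* If psi <= chi then psi is equivalent to psi /\ chi. *)
Lemma CL_imp_mono phi psi chi : CL G psi chi -> CL G (Imp phi psi) (Imp phi chi).
Proof.
move=> psi_chi; apply: (CL_trans (psi := Imp phi (And psi chi))).
  by apply: CL_congr; [apply: CL_andI => //; apply: CL_refl|apply: CL_and_le1].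
exact: CL_trans (CL_imp_andE _ _ _) (CL_and_le2 _ _).
Qed.

End Derivations.

(** * The meet-semilattice of theories *)

Record theory (G : set (formula * formula)) := Theory {
  theory_set :> set formula;
  theory_top : theory_set Top;
  theory_and : forall phi psi,
    theory_set phi -> theory_set psi -> theory_set (And phi psi);
  theory_up : forall phi psi, CL G phi psi -> theory_set phi -> theory_set psi }.

Section TheoryOrder.
Variable G : set (formula * formula).
Implicit Types (x y z : theory G) (phi psi : formula).

Lemma theory_eq x y : x = y :> set formula -> x = y.
Proof.
case: x y => [A At Am Au] [B Bt Bm Bu] /= AB; case: B / AB Bt Bm Bu => Bt Bm Bu.
by rewrite (Prop_irrelevance At Bt) (Prop_irrelevance Am Bm)
  (Prop_irrelevance Au Bu).
Qed.

Definition theoryT : theory G.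
Proof. by refine (@Theory G setT _ _ _). Defined.

Definition theoryI x y : theory G.
Proof.
refine (@Theory G (x `&` y) _ _ _).
- by split; apply: theory_top.
- by move=> phi psi [xp yp] [xq yq]; split; apply: theory_and.
- by move=> phi psi pq [xp yp]; split; apply: theory_up pq _.
Defined.

Definition principal phi : theory G.
Proof.
refine (@Theory G (CL G phi) _ _ _).
- exact: CL_le_top.
- by move=> psi chi; apply: CL_andI.
- by move=> psi chi pq qr; apply: CL_trans qr pq.
Defined.

HB.instance Definition _ := gen_eqMixin (theory G).
HB.instance Definition _ := gen_choiceMixin (theory G).

Definition theory_le x y : bool := `[< x `<=` y >].

Lemma theory_le_refl : reflexive theory_le.
Proof. by move=> x; apply/asboolP. Qed.

Lemma theory_le_anti : antisymmetric theory_le.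
Proof.
move=> x y /andP[/asboolP xy /asboolP yx].
by apply: theory_eq; apply/seteqP; split.
Qed.

Lemma theory_le_trans : transitive theory_le.
Proof.
by move=> y x z /asboolP xy /asboolP yz; apply/asboolP; apply: subset_trans yz.
Qed.

HB.instance Definition _ := Order.Le_isPOrder.Build (Order.Disp tt tt) (theory G)
  theory_le_refl theory_le_anti theory_le_trans.

Lemma theory_lexI x y z :
  (x <= theoryI y z)%O = (x <= y)%O && (x <= z)%O.
Proof.
by rewrite /Order.le /= /theory_le /= subsetI asbool_and.
Qed.

HB.instance Definition _ :=
  Order.POrder_isMeetSemilattice.Build (Order.Disp tt tt) (theory G) theory_lexI.

Lemma theory_lex1 x : (x <= theoryT)%O.
Proof. exact/asboolP. Qed.

HB.instance Definition _ :=
  Order.hasTop.Build (Order.Disp tt tt) (theory G) theory_lex1.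

Lemma theory_leP x y : reflect (x `<=` y) (x <= y)%O.
Proof. exact: asboolP. Qed.

End TheoryOrder.

(** * The canonical selection frame *)

Section CanonicalFrame.
Variable G : set (formula * formula).
Implicit Types (x y z : theory G) (a b : sfilter (theory G)).
Implicit Types phi psi chi : formula.

Definition defines phi a := forall z, a z <-> z phi.

Definition theory_filter phi : sfilter (theory G).
Proof.
refine (@SFilter _ (theory G) [set x | x phi] _ _ _).
- by [].
- by move=> x y xp yp; split.
- by move=> x y /theory_leP xy /xy.
Defined.

Lemma defines_theory_filter phi : defines phi (theory_filter phi).
Proof. by []. Qed.

(** The principal theory of [phi] contains [phi], hence lies in [a], hence contains [psi]. *)
Lemma defines_CL a phi psi : defines phi a -> defines psi a -> CL G phi psi.
Proof.
move=> pa qa; have /qa// : a (principal G phi) by apply/pa/CL_refl.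
Qed.

(** The theory x_a. Quantifying over all defining formulas avoids a choice among them and gives the
    improper theory when there are none. *)
Definition consequents x a : theory G.
Proof.
refine (@Theory G [set psi | forall phi, defines phi a -> x (Imp phi psi)] _ _ _).
- by move=> phi _; apply: theory_up (theory_top x); apply: CL_top_imp.
- move=> psi chi xpsi xchi phi pa.
  by apply: theory_up (CL_imp_andI _ _ _ _) _; apply: theory_and; auto.
- by move=> psi chi pq xp phi pa; apply: theory_up (CL_imp_mono _ pq) (xp _ pa).
Defined.

(** Any two formulas defining [a] are interderivable, so by congruence in the antecedent one of them
    decides membership. *)
Lemma consequents_definable x a phi psi :
  defines phi a -> consequents x a psi <-> x (Imp phi psi).
Proof.
move=> pa; split=> [/(_ _ pa)//|xpq chi ca].
by apply: theory_up xpq; apply: CL_congl; apply: defines_CL; eassumption.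
Qed.

Definition canonical_sel x a : sfilter (theory G).
Proof.
refine (@SFilter _ (theory G) [set y | (consequents x a <= y)%O] _ _ _).
- exact: lex1.
- by move=> y z /= xy xz; rewrite lexI xy.
- by move=> y z yz /= xy; apply: le_trans yz.
Defined.

Lemma canonical_sel_top a : canonical_sel \top%O a = [set \top%O] :> set (theory G).
Proof.
apply/seteqP; split=> y /=; last by move=> ->; apply: lex1.
move=> /theory_leP top_y; apply/eqP; rewrite -le1x; apply/theory_leP => phi _.
exact: top_y.
Qed.

Lemma canonical_sel_le x y a : (x <= y)%O -> canonical_sel y a `<=` canonical_sel x a.
Proof.
move=> /theory_leP xy z; apply: le_trans; apply/theory_leP => psi xpsi phi pa.
exact/xy/xpsi.
Qed.

Lemma canonical_sel_meet x y z a : canonical_sel (x `&` y)%O a z ->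
  exists u v, [/\ canonical_sel x a u, canonical_sel y a v & (u `&` v <= z)%O].
Proof.
(* The witnesses are the least elements of the two selected filters; their intersection lies in
   [consequents] of the meet. *)
move=> /= xyz; exists (consequents x a), (consequents y a); split=> //=.
apply: le_trans xyz; apply/theory_leP => psi [xpsi ypsi] phi pa.
by split; [apply: xpsi|apply: ypsi].
Qed.

Definition canonical_frame : selection_Lframe :=
  SelectionLFrame canonical_sel_top canonical_sel_le canonical_sel_meet.

(** * Truth lemma and completeness *)

Definition canonical_valuation (n : nat) : sfilter canonical_frame :=
  theory_filter (Var n).

Lemma truth_set_canonical phi :
  truth_set canonical_valuation phi = theory_filter phi.
Proof.
elim: phi => [n|||phi1 IH1 phi2 IH2|phi1 IH1 phi2 IH2|phi1 IH1 phi2 IH2];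
  apply: sfilter_eq; apply/seteqP; split=> x //=; rewrite ?IH1 ?IH2 /=.
- by move=> _; apply: theory_top.
- by move=> ->.
- move=> xbot; apply: theory_eq; apply/seteqP; split=> // phi _.
  by apply: theory_up xbot; apply: CL_bot_le.
- by move=> [x1 x2]; apply: theory_and.
- by move=> x12; split; apply: theory_up x12; [apply: CL_and_le1|apply: CL_and_le2].
- move=> [y [z [y1 z2 /theory_leP]]]; apply; split.
    exact: theory_up (CL_or_ge1 _ _ _) y1.
  exact: theory_up (CL_or_ge2 _ _ _) z2.
(* By disjunction elimination, whatever follows from both disjuncts follows from the disjunction,
   hence is in [x]. *)
- move=> x12; exists (principal G phi1), (principal G phi2).
  split; [exact: CL_refl..|]; apply/theory_leP => psi [p1 p2].
  by apply: theory_up x12; apply: CL_orE.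
(* It suffices to test the inclusion at the least selected world. *)
- move=> /(_ (consequents x (theory_filter phi1)) (lexx _)) /=.
  by move/(consequents_definable _ _ (defines_theory_filter _)).
- move=> x12 y /theory_leP; apply.
  exact/(consequents_definable _ _ (defines_theory_filter _)).
Qed.

(** At the world [principal G phi], [phi] holds and exactly its consequences are true. *)
Lemma canonical_complete phi psi : validates canonical_frame phi psi -> CL G phi psi.
Proof.
move=> /(_ canonical_valuation (principal G phi)).
by rewrite !truth_set_canonical; apply; apply: CL_refl.
Qed.

(** * Frame conditions from the axioms *)

Lemma canonical_sel_sub x a b :
    (forall phi, defines phi a -> canonical_sel x a `<=` b) ->
  canonical_sel x a `<=` b.
Proof.
move=> defb; have [[phi /defb//]|ndef] := pselect (exists phi, defines phi a).
(* With no defining formula, [consequents x a] is improper, so [y] is the top and lies in every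
   filter. *)
move=> y /theory_leP xy; apply: (sfilter_up _ (sfilter_top b)).
by apply/theory_leP => psi _; apply: xy => phi pa; case: ndef; exists phi.
Qed.

(* The second premise says [x <= consequents x a]. *)
Lemma canonical_sel_centered x a b : b x ->
    (forall phi psi, defines phi a -> x psi -> x (Imp phi psi)) ->
  canonical_sel x a `<=` b.
Proof.
move=> bx xpsi y; move/sfilter_up; apply; apply: sfilter_up bx.
by apply/theory_leP => psi xp phi pa; apply: xpsi.
Qed.

Lemma canonical_axiom ax : G (axiom_pair ax) -> axiom_condition canonical_frame ax.
Proof.
move=> Gax; have inst phi psi :
    CL G (subst (subst3 phi psi psi) (axiom_pair ax).1)
         (subst (subst3 phi psi psi) (axiom_pair ax).2).
  by apply: CL_subst; apply: CL_ax; rewrite -surjective_pairing.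
case: ax {Gax} inst => /= inst x.
- move=> a; apply: canonical_sel_sub => phi pa y /theory_leP xy.
  apply/pa/xy/(consequents_definable _ _ pa).
  exact: theory_up (inst phi phi) (theory_top x).
- move=> a ax; apply: canonical_sel_centered => // phi psi pT xpsi.
  apply: theory_up xpsi; apply: CL_trans (inst psi psi) _.
  apply: CL_congl; last exact: CL_le_top.
  (* Since [phi] defines the full filter, it belongs even to the least theory, so [Top] derives
     it. *)
  by have /pT : sfilterT (theory G) (principal G Top).
- move=> a b ax; apply: canonical_sel_centered => // phi psi _.
  exact: theory_up (inst psi phi).
- move=> a b [ax bx]; apply: canonical_sel_centered => // phi psi pa xpsi.
  (* The world [x] lies in [a], so it contains the defining formula [phi] as well as [psi]. *)
  by apply: theory_up (inst phi psi) _; apply: theory_and => //; apply/pa.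
Qed.

End CanonicalFrame.

Unset Implicit Arguments.

Theorem theorem5p3 (Ax : set axiom_name) (phi psi : formula) :
  CL (axiom_pair @` Ax) phi psi <->
  (forall F : selection_Lframe,
     (forall ax : axiom_name, Ax ax -> axiom_condition F ax) -> validates F phi psi).
Proof.
split=> [phi_psi F F_Ax|valid].
  by apply: CL_sound phi_psi => _ [ax /F_Ax/axiom_valid ? <-].
apply: canonical_complete; apply: valid => ax Aax.
by apply: canonical_axiom; exists ax.
Qed.
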